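(* Let $s,t,v\ge0$ be integers. Any storage-balanced schedule, on the $p$-processor parallel machine, of any execution DAG of the direct evaluation algorithm $\Psi^{(s,t,v)}$ for symmetric tensor contractions of dimension $n$ has horizontal communication cost $$W_\Psi(n,s,t,v,p)=\Omega\big(W_{\mathrm O}(n^{x},n^{y},n^{z},p)\big),\qquad x=\min(s,t,v),\ y=\operatorname{median}(s,t,v),\ z=\max(s,t,v),$$ where $$W_{\mathrm O}(n^x,n^y,n^z,p)=\begin{cases}\left(\dfrac{n^{x+y+z}}{p}\right)^{2/3} & \text{if } p>n^{y+z-2x},\\[2mm] n^x\left(\dfrac{n^{y+z}}{p}\right)^{1/2} & \text{if } n^{y+z-2x}\ge p>n^{z-y},\\[2mm] n^{x+y} & \text{if } n^{z-y}\ge p.\end{cases}$$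
   Context: Asymptotics. $n$ and $p$ are asymptotic parameters and $s,t,v$ are constants: $W=\Omega(f(n,p))$ means that there are constants $\gamma>0,n_0,p_0$ depending only on $s,t,v$ such that $W\ge\gamma f(n,p)$ for every schedule of the stated type, for all $n\ge n_0$, $p\ge p_0$ satisfying the divisibility assumption below. Bilinear algorithm. A bilinear algorithm is a triple of real matrices $(F^{(A)},F^{(B)},F^{(C)})$ with the same number of columns. On input vectors $a,b$ it computes $c=F^{(C)}\big[((F^{(A)})^{\mathsf T}a)\odot((F^{(B)})^{\mathsf T}b)\big]$, $\odot$ being the entrywise product. Its rank is the number of columns. Tuples. Let $I_n^d=\{(i_1,\dots,i_d)\in\{1,\dots,n\}^d: i_1\le\dots\le i_d\}$, so $|I_n^d|=\binom{n+d-1}{d}$. For a tuple $k$ of length $q+r$, $\chi^q_r(k)$ is the collection of all pairs of tuples of lengths $q$ and $r$ obtained by choosing $q$ positions of $k$, listing the entries at these positions in order, and listing the remaining entries in order. For a tuple $k$ of length $v$, $\rho(k)=v!/\prod_i m_i!$ where $m_i$ are the multiplicities of the distinct values of $k$. Direct evaluation algorithm $\Psi^{(s,t,v)}$. It computes the symmetrized contraction over $v$ indices of a symmetric tensor $A$ of order $s+v$ with a symmetric tensor $B$ of order $v+t$ into a symmetric tensor $C$ of order $s+t$, all dimensions $n$, storing only entries with nondecreasing index tuples. As a bilinear algorithm: rows of $F^{(A)},F^{(B)},F^{(C)}$ are indexed by $I_n^{s+v},I_n^{v+t},I_n^{s+t}$ respectively (so $a,b,c$ are the unique entries of $A,B,C$),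 columns by triples $(j,l,k)\in I_n^s\times I_n^t\times I_n^v$. The only nonzeros are: $F^{(A)}_{g,(j,l,k)}=1$ if $(j,k)\in\chi^s_v(g)$; $F^{(B)}_{h,(j,l,k)}=1$ if $(k,l)\in\chi^v_t(h)$; $F^{(C)}_{i,(j,l,k)}=s!\,t!\,\rho(k)$ if $(j,l)\in\chi^s_t(i)$. Execution DAG. An execution DAG of a bilinear algorithm is a directed acyclic graph $G=(V,E)$ in which each vertex has in-degree $0$ (an input value, i.e. an entry of $a$ or $b$) or in-degree $2$ (the result of a weighted addition or of a multiplication of its two predecessors). $V$ is a disjoint union $V^{(A)}\cup V^{(B)}\cup V^{(C)}$: vertices of $V^{(A)}$ (resp. $V^{(B)}$) are linear combinations of entries of $a$ (resp. $b$), vertices of $V^{(C)}$ are the computed products and linear combinations of products; $V^{(M)}\subseteq V^{(C)}$ is the set of computed products, one for each column. The outputs (entries of $c$) are vertices of $V^{(C)}$. Edges go within $V^{(A)}$, within $V^{(B)}$ (these compute, by additions, the operands of the products), from $V^{(A)}$ to $V^{(M)}$ and from $V^{(B)}$ to $V^{(M)}$ (each product has exactly one operand from each), and from $V^{(C)}$ to $V^{(C)}\setminus V^{(M)}$ (summations computing the outputs as prescribed by $F^{(C)}$). Parallel machine with $p$ processors. The processors have a fully connected network and exchange elements (vertex values) by point-to-point messages. A parallel schedule of an execution DAG assigns each non-input vertex to exactly one processor, which computes it (no recomputation); operands must be present on that processor, either because it initially owned them, computed them, or received them. Each input element is on exactly one processor at the start. The horizontal communication cost $W$ is the largest, over processors,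 total number of elements sent and received by that processor. A schedule is storage-balanced if at the start each processor owns exactly a $1/p$ fraction of the entries of each of $a$ and $b$, and at the end each processor owns exactly a $1/p$ fraction of the entries of $c$, each output entry being on a unique processor. It is assumed that $p$ divides the number of entries of each of $a,b,c$ and the number of products (columns). *)

(* Defs.v *)
From mathcomp Require Import all_boot all_order all_algebra.
From mathcomp Require Import boolp classical_sets reals exp.

Set Implicit Arguments.
Unset Strict Implicit.
Unset Printing Implicit Defensive.

Import Order.TTheory GRing.Theory Num.Theory.
Local Open Scope ring_scope.

Record bilinear_algorithm (R : realType) (dA dB dC r : nat) :=
  BilinearAlgorithm {
    FA : 'M[R]_(dA, r);
    FB : 'M[R]_(dB, r);
    FC : 'M[R]_(dC, r)
  }.

Definition bilinear_eval (R : realType) (dA dB dC r : nat)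
    (alg : bilinear_algorithm R dA dB dC r) (a : 'cV[R]_dA) (b : 'cV[R]_dB) :
    'cV[R]_dC :=
  FC alg *m map2_mx *%R ((FA alg)^T *m a) ((FB alg)^T *m b).

Definition inc_tuple (n d : nat) : finType :=
  {k : d.-tuple 'I_n | sorted leq (map val k)}.

(* The mask [m] marks the chosen positions; the types of the two components
   force [m] to have exactly [q] true entries. *)
Definition chi (n q r : nat) (k : (q + r).-tuple 'I_n) :
    {set q.-tuple 'I_n * r.-tuple 'I_n} :=
  [set jl | [exists m : (q + r).-tuple bool,
     (val jl.1 == mask m k) && (val jl.2 == mask (map negb m) k)]].

Definition rho (R : realType) (n v : nat) (k : v.-tuple 'I_n) : R :=
  (v`!)%:R / (\prod_(i < n) (count_mem i k)`!)%:R.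

Definition psi_column (n s t v : nat) : finType :=
  (inc_tuple n s * inc_tuple n t * inc_tuple n v)%type.

(* Rows and columns are numbered by the enumerations of their index types. *)
Definition Psi (R : realType) (n s t v : nat) :
    bilinear_algorithm R #|{: inc_tuple n (s + v)}| #|{: inc_tuple n (v + t)}|
      #|{: inc_tuple n (s + t)}| #|{: psi_column n s t v}| :=
  {| FA := \matrix_(g, c)
       let: (j, l, k) := (enum_val c : psi_column n s t v) in
       let g' : inc_tuple n (s + v) := enum_val g in
       if (val j, val k) \in chi (val g') then 1 else 0;
     FB := \matrix_(h, c)
       let: (j, l, k) := (enum_val c : psi_column n s t v) in
       let h' : inc_tuple n (v + t) := enum_val h in
       if (val k, val l) \in chi (val h') then 1 else 0;
     FC := \matrix_(i, c)
       let: (j, l, k) := (enum_val c : psi_column n s t v) in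
       let i' : inc_tuple n (s + t) := enum_val i in
       if (val j, val l) \in chi (val i')
       then (s`!)%:R * (t`!)%:R * rho R (val k) else 0 |}.

Definition preds (V : finType) (e : rel V) (w : V) : {set V} :=
  [set u | e u w].

(* [valA w], [valB w] are the linear forms in the entries of [a], [b] held by
   a vertex of [VA], [VB], and [valC w] is the linear combination of the
   products (one coordinate per column) held by a vertex of [VC].  Since the
   graph is acyclic, the edge weights determine them on these parts through
   [valA_in] to [valC_add]; their values elsewhere play no role. *)
Record execution_dag (R : realType) (dA dB dC r : nat)
    (alg : bilinear_algorithm R dA dB dC r) := ExecutionDag {
  vertex : finType;
  edge : rel vertex;
  weight : vertex -> vertex -> R;
  VA : {set vertex};
  VB : {set vertex};
  VC : {set vertex};
  inA : 'I_dA -> vertex;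
  inB : 'I_dB -> vertex;
  product : 'I_r -> vertex;
  out : 'I_dC -> vertex;
  valA : vertex -> 'cV[R]_dA;
  valB : vertex -> 'cV[R]_dB;
  valC : vertex -> 'rV[R]_r;

  edge_acyclic : forall c : seq vertex, cycle edge c -> c = [::];
  parts_cover : VA :|: VB :|: VC = [set: vertex];
  parts_disjoint :
    [/\ [disjoint VA & VB], [disjoint VA & VC] & [disjoint VB & VC]];
  inA_inj : injective inA;
  inB_inj : injective inB;
  product_inj : injective product;
  inA_VA : forall g, inA g \in VA;
  inB_VB : forall h, inB h \in VB;
  product_VC : forall c, product c \in VC;
  out_VC : forall i, out i \in VC;
  indegree : forall w, #|preds edge w| =
    if (w \in codom inA) || (w \in codom inB) then 0%N else 2%N;
  edge_parts : forall u w, edge u w ->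
    [\/ u \in VA /\ w \in VA,
        u \in VB /\ w \in VB,
        (u \in VA \/ u \in VB) /\ w \in codom product |
        u \in VC /\ w \in VC :\: [set x in codom product]];

  valA_in : forall g, valA (inA g) = delta_mx g 0;
  valB_in : forall h, valB (inB h) = delta_mx h 0;
  valC_product : forall c, valC (product c) = delta_mx 0 c;
  valA_add : forall w, w \in VA -> w \notin codom inA ->
    valA w = \sum_(u in preds edge w) weight u w *: valA u;
  valB_add : forall w, w \in VB -> w \notin codom inB ->
    valB w = \sum_(u in preds edge w) weight u w *: valB u;
  valC_add : forall w, w \in VC -> w \notin codom product ->
    valC w = \sum_(u in preds edge w) weight u w *: valC u;

  product_operands : forall c, exists uA uB : vertex,
    [/\ uA \in VA, uB \in VB, preds edge (product c) = [set uA; uB],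
        valA uA = col c (FA alg) & valB uB = col c (FB alg)];
  out_val : forall i, valC (out i) = row i (FC alg)
}.

Section Schedules.
Variables (R : realType) (dA dB dC r : nat).
Variables (alg : bilinear_algorithm R dA dB dC r) (G : execution_dag alg).
Variable p : nat.

(* A parallel execution is given by a linearization of its computations and of
   its transfers of single elements; a message carrying several elements is
   several transfers, since only the number of elements matters for the cost. *)
Inductive event :=
  | Compute of 'I_p & vertex G
  | Transfer of 'I_p & 'I_p & vertex G.

(* [(q, w) \in S] means that the value of [w] is present on processor [q]. *)
Definition memory := {set 'I_p * vertex G}.

Definition enabled (S : memory) (e : event) : bool :=
  match e with
  | Compute q w => [forall u, edge u w ==> ((q, u) \in S)]
  | Transfer src dst w => (src != dst) && ((src, w) \in S)
  end.

Definition step (S : memory) (e : event) : memory :=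
  match e with
  | Compute q w => (q, w) |: S
  | Transfer src dst w => (dst, w) |: S
  end.

Fixpoint valid_trace (S : memory) (es : seq event) : bool :=
  if es is e :: es' then enabled S e && valid_trace (step S e) es' else true.

Definition computes (w : vertex G) (e : event) : bool :=
  if e is Compute _ w' then w' == w else false.

Definition involves (q : 'I_p) (e : event) : bool :=
  if e is Transfer src dst _ then (src == q) || (dst == q) else false.

Definition initial_memory (hA : 'I_dA -> 'I_p) (hB : 'I_dB -> 'I_p) : memory :=
  [set (hA g, inA G g) | g : 'I_dA] :|: [set (hB h, inB G h) | h : 'I_dB].

(* [homeA], [homeB] place the inputs at the start, [homeC] the outputs at the
   end. *)
Record schedule := Schedule {
  homeA : 'I_dA -> 'I_p;
  homeB : 'I_dB -> 'I_p;
  homeC : 'I_dC -> 'I_p;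
  trace : seq event;
  trace_valid : valid_trace (initial_memory homeA homeB) trace;
  trace_computes : forall w : vertex G, count (computes w) trace =
    if (w \in codom (inA G)) || (w \in codom (inB G)) then 0%N else 1%N;
  trace_outputs : forall i : 'I_dC,
    (homeC i, out G i) \in foldl step (initial_memory homeA homeB) trace
}.

Definition storage_balanced (sch : schedule) : Prop :=
  forall q : 'I_p,
    [/\ (p * #|[set g | homeA sch g == q]| = dA)%N,
        (p * #|[set h | homeB sch h == q]| = dB)%N &
        (p * #|[set i | homeC sch i == q]| = dC)%N].

Definition horizontal_cost (sch : schedule) : nat :=
  \max_(q < p) count (involves q) (trace sch).

End Schedules.

Definition median3 (s t v : nat) : nat := nth 0%N (sort leq [:: s; t; v]) 1.

(* Used only for [x <= y <= z], so that no natural subtraction truncates. *)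
Definition W_O (R : realType) (n x y z p : nat) : R :=
  if (n ^ (y + z - 2 * x) < p)%N then
    ((n ^ (x + y + z))%:R / p%:R) `^ (2%:R / 3%:R)
  else if (n ^ (z - y) < p)%N then
    (n ^ x)%:R * ((n ^ (y + z))%:R / p%:R) `^ (1 / 2%:R)
  else (n ^ (x + y))%:R.

(* Main.v *)
(* A processor [q] computing a 1/p share of the products touches, by the discrete
   Loomis-Whitney inequality, index sets of A, B and C whose sizes multiply to
   at least a constant times (n^(s+t+v) / p)^2: the triple (j, l, k) needs the
   entries of A at j u k and of B at k u l, and contributes to that of C at j u l.
   Linear algebra bounds these sizes whatever the additions of the DAG are: the
   A-values ever present on [q] span a space of dimension at most (entries owned)
   + (elements received), and the values held by the other processors, restricted
   to the products of [q], span a space of dimension at most (elements sent).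
   Storage balance makes the owned parts n^(s+v)/p, n^(v+t)/p, n^(s+t)/p, whose
   product is smaller than needed by a factor p, so for large p the communicated
   part W satisfies the bound; [W_O] is the minimum of the three values of W at
   which some term of the expanded product becomes large enough. *)
Require Import Defs.
From mathcomp Require Import all_boot all_order all_algebra.
From mathcomp Require Import reals exp.
From mathcomp Require Import zify ring lra.

Set Implicit Arguments.
Unset Strict Implicit.
Unset Printing Implicit Defensive.

Import Order.TTheory GRing.Theory Num.Theory.
Local Open Scope ring_scope.

(** * Dimension counts for the values held during an execution *)

(** Restricted to the pivot columns the family is diagonal with nonzero diagonal, hence linearly
    independent. *)
Lemma rank_pivot_family (F : fieldType) (m d : nat) (I : finType) (A : {set I})
    (f : I -> 'rV[F]_d) (piv : I -> 'I_d) (U : 'M[F]_(m, d)) :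
  (forall i j, i \in A -> j \in A -> (f i 0 (piv j) != 0) = (i == j)) ->
  (forall i, i \in A -> (f i <= U)%MS) -> (#|A| <= \rank U)%N.
Proof.
move=> fpiv fU.
pose B := \matrix_(k < #|A|) f (enum_val k).
have BU : (B <= U)%MS.
  by apply/row_subP => k; rewrite rowK; apply/fU/enum_valP.
apply: leq_trans (mxrankS BU).
suff /eqP-> : row_free B by [].
apply/row_freeP.
(* An explicit right inverse: column [k] reads the pivot coordinate of row [k] and rescales it to
   1. *)
exists (\matrix_(c, k) ((c == piv (enum_val k))%:R / f (enum_val k) 0 c)).
apply/matrixP => k k'; rewrite !mxE (bigD1 (piv (enum_val k'))) //= big1 => [|c cN].
  rewrite !mxE eqxx addr0 mul1r.
  have fk := fpiv _ _ (enum_valP k) (enum_valP k').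
  have := fpiv _ _ (enum_valP k') (enum_valP k'); rewrite eqxx => f0.
  case: (eqVneq k k') fk => [-> _|kk']; first by rewrite divff.
  by rewrite (inj_eq enum_val_inj) (negPf kk') => /negbT; rewrite negbK => /eqP->; rewrite mul0r.
by rewrite !mxE (negPf cN) mul0r mulr0.
Qed.

Section Traces.
Variables (R : realType) (dA dB dC r : nat).
Variables (alg : bilinear_algorithm R dA dB dC r) (G : execution_dag alg).
Variable p : nat.
Implicit Types (S : memory G p) (es : seq (event G p)) (e : event G p).

Definition computes_on (q : 'I_p) (w : vertex G) e : bool :=
  if e is Compute q' w' then (q' == q) && (w' == w) else false.

(** [Q] is a single processor when receptions are counted, and the complement of one when the
    elements it sends are counted. *)
Definition enters (Q : pred 'I_p) e : bool :=
  if e is Transfer src dst _ then ~~ Q src && Q dst else false.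

Lemma memory_step_sub S e : S \subset step S e.
Proof. by case: e => [q w|q q' w]; apply: subsetUr. Qed.

Lemma memory_final_sub S es : S \subset foldl (@step _ _ _ _ _ _ _ p) S es.
Proof.
elim: es S => [|e es IH] S //=.
exact: subset_trans (memory_step_sub S e) (IH _).
Qed.

(** Memory never shrinks, so an operand present when [w] is computed is still there at the end; only
    the final memory has to be studied. *)
Lemma operands_in_memory S es q w u :
  valid_trace S es -> has (computes_on q w) es -> edge u w ->
  (q, u) \in foldl (@step _ _ _ _ _ _ _ p) S es.
Proof.
elim: es S => [|e es IH] S //= /andP[en val] /orP[on|hw] uw; last exact: IH.
case: e en on val => //= q' w' /forallP/(_ u)/implyP en /andP[/eqP Eq /eqP Ew] _.
rewrite -Eq; apply: (subsetP (memory_final_sub _ _)).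
by rewrite inE; apply/orP; right; apply: en; rewrite Ew.
Qed.

(* A group [Q] of processors can only produce, by itself, linear combinations of
   what it holds; each incoming transfer enlarges the span by one dimension at
   most. *)
Lemma memory_span (d m : nat) (Q : pred 'I_p) (X : {set vertex G})
    (val : vertex G -> 'rV[R]_d) (ok : pred (event G p)) S es (U0 : 'M[R]_(m, d)) :
  valid_trace S es -> all ok es ->
  (forall q w (U : 'M[R]_d), ok (Compute q w) -> Q q -> w \in X ->
     (forall u, edge u w -> u \in X -> (val u <= U)%MS) -> (val w <= U)%MS) ->
  (forall q w, (q, w) \in S -> Q q -> w \in X -> (val w <= U0)%MS) ->
  exists U : 'M[R]_d, (\rank U <= \rank U0 + count (enters Q) es)%N /\
    forall q w, (q, w) \in foldl (@step _ _ _ _ _ _ _ p) S es -> Q q -> w \in X ->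
      (val w <= U)%MS.
Proof.
move=> + + okP; elim: es m S U0 => [|e es IH] m S U0 /=.
  move=> _ _ SU0; exists <<U0>>%MS; rewrite genmxE addn0; split=> // q w qw Qq wX.
  by rewrite genmxE; apply: SU0 qw Qq wX.
move=> /andP[en vt] /andP[oke okes] SU0.
have [W [rW SW]] : exists W : 'M[R]_d, (\rank W <= \rank U0 + enters Q e)%N /\
    forall q w, (q, w) \in step S e -> Q q -> w \in X -> (val w <= W)%MS.
  case: e en oke {vt} => [q w|src dst w] /= en oke.
    exists <<U0>>%MS; rewrite genmxE addn0; split=> // q' w'.
    rewrite !inE => /orP[/eqP[-> ->]|qS] Qq wX; rewrite ?genmxE.
      have := okP _ _ <<U0>>%MS oke Qq wX; rewrite genmxE; apply=> u uw uX.
      rewrite genmxE; apply: SU0 Qq uX.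
      by move/forallP/(_ u)/implyP: en; apply.
    exact: SU0 qS Qq wX.
  have /andP[_ srcw] := en.
  case: (boolP (~~ Q src && Q dst)) => [_|out].
    exists (U0 + val w)%MS; split.
      apply: leq_trans (mxrank_adds_leqif _ _) _.
      by rewrite leq_add2l rank_leq_row.
    move=> q' w'; rewrite !inE => /orP[/eqP[-> ->]|qS] Qq wX.
      exact: addsmxSr.
    exact: submx_trans (SU0 _ _ qS Qq wX) (addsmxSl _ _).
  (* No crossing into [Q]: if the receiver is in [Q], so is the sender, and the value already lies
     in the span. *)
  exists <<U0>>%MS; rewrite genmxE addn0; split=> // q' w'.
  rewrite !inE => /orP[/eqP[-> ->]|qS] Qq wX; rewrite genmxE.
    by move: out; rewrite Qq andbT negbK => Qsrc; apply: SU0 srcw Qsrc wX.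
  exact: SU0 qS Qq wX.
have [U [rU SU]] := IH _ _ _ vt okes SW.
exists U; split=> //; apply: leq_trans rU _.
by rewrite addnA leq_add2r.
Qed.

Variable sch : schedule G p.

Let initial := initial_memory G (homeA sch) (homeB sch).
Let final := foldl (@step _ _ _ _ _ _ _ p) initial (trace sch).

Definition computed_products (q : 'I_p) : {set 'I_r} :=
  [set c | has (computes_on q (product G c)) (trace sch)].

Lemma parts_exclusive w :
  [/\ w \in VA G -> w \in VB G -> False, w \in VA G -> w \in VC G -> False
    & w \in VB G -> w \in VC G -> False].
Proof.
by have [dAB dAC dBC] := parts_disjoint G;
   split=> wX wY; have := disjoint_setI0 dAB; have := disjoint_setI0 dAC;
   have := disjoint_setI0 dBC => /setP/(_ w) + /setP/(_ w) + /setP/(_ w);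
   rewrite !inE wX wY.
Qed.

Lemma codom_product_VC w : w \in codom (product G) -> w \in VC G.
Proof. by case/codomP => c ->; apply: product_VC. Qed.

Lemma edge_VA u w : edge u w -> w \in VA G -> u \in VA G.
Proof.
have [nAB nAC _] := parts_exclusive w.
move=> /edge_parts[[]|[_ wB]|[_ /codom_product_VC wC]|[_ /setDP[wC _]]] // wA.
- by case: nAB. - by case: nAC. - by case: nAC.
Qed.

Lemma edge_VB u w : edge u w -> w \in VB G -> u \in VB G.
Proof.
have [nAB _ nBC] := parts_exclusive w.
move=> /edge_parts[[_ wA]|[]|[_ /codom_product_VC wC]|[_ /setDP[wC _]]] // wB.
- by case: nAB. - by case: nBC. - by case: nBC.
Qed.

Lemma edge_VC u w : edge u w -> w \in VC G -> w \notin codom (product G) -> u \in VC G.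
Proof.
have [_ nAC nBC] := parts_exclusive w.
move=> /edge_parts[[_ wA]|[_ wB]|[_ ->]|[]] // wC.
- by case: nAC. - by case: nBC.
Qed.

Definition is_input (w : vertex G) := (w \in codom (inA G)) || (w \in codom (inB G)).

Definition computes_input e := if e is Compute _ w then is_input w else false.

(** An input has no predecessors, so a [Compute] event on it would always be enabled and create its
    value for free; the zero count in [trace_computes] excludes this. *)
Lemma no_input_computed : all (predC computes_input) (trace sch).
Proof.
rewrite all_predC; apply/negP => has_in.
have [w win hw] : exists2 w, is_input w & has (computes w) (trace sch).
  elim: (trace sch) has_in => //= e es IH /orP[|/IH[w win hw]].
    by case: e => // q w win; exists w => //=; rewrite eqxx.
  by exists w => //; rewrite hw orbT.
have := trace_computes sch w; rewrite -/(is_input w) win => /eqP.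
by rewrite -leqn0 leqNgt -has_count hw.
Qed.

(** Common argument for A and B: [q] starts with one unit vector per owned entry and each reception
    adds at most one dimension, while the unit vectors indexed by [K] are all present at the end. *)
Lemma operands_bound (d : nat) (home : 'I_d -> 'I_p) (X : {set vertex G})
    (val : vertex G -> 'cV[R]_d) (q : 'I_p) (K : {set 'I_d}) :
  (forall w, w \in X -> (q, w) \in initial ->
     exists2 g, home g = q & val w = delta_mx g 0) ->
  (forall w, w \in X -> ~~ is_input w ->
     val w = \sum_(u in preds (edge (e:=G)) w) weight u w *: val u) ->
  (forall u w, edge u w -> w \in X -> u \in X) ->
  (forall g, g \in K -> exists2 w, w \in X & (q, w) \in final /\ val w = delta_mx g 0) ->
  (#|K| <= #|[set g | home g == q]| + count (involves q) (trace sch))%N.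
Proof.
move=> val_init val_add edgeX KP.
pose H := [set g | home g == q].
pose U0 : 'M[R]_(#|H|, d) := \matrix_(i < #|H|) delta_mx 0 (enum_val i).
have [||U [rU SU]] := @memory_span d _ (pred1 q) X (fun w => (val w)^T)
    (predC computes_input) initial (trace sch) U0 (trace_valid sch) no_input_computed.
- move=> q' w U /= win _ wX opU.
  have -> : (val w)^T = \sum_(u in preds (edge (e:=G)) w) weight u w *: (val u)^T.
    apply/rowP => j; rewrite mxE val_add // !summxE.
    by apply: eq_bigr => u _; rewrite !mxE.
  rewrite summx_sub // => u; rewrite inE => uw; apply: scalemx_sub.
  exact: opU (edgeX _ _ uw wX).
- move=> q' w + /eqP q'q wX; rewrite {}q'q => /(val_init _ wX)[g gq ->].
  rewrite trmx_delta; have gH : g \in H by rewrite inE gq.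
  by rewrite -(enum_rankK_in gH gH) -(rowK (fun i => delta_mx 0 (enum_val i)) _) row_sub.
apply: leq_trans (leq_add (rank_leq_row U0) (_ : count (enters (pred1 q)) (trace sch) <= _)%N).
  apply: leq_trans rU.
  apply: (@rank_pivot_family _ _ _ _ K (fun g => delta_mx 0 g) id).
    by move=> i j _ _; rewrite mxE eqxx /= pnatr_eq0 eqb0 negbK eq_sym.
  move=> g /KP[w wX [qw vw]]; rewrite -[delta_mx 0 g]trmx_delta -vw.
  exact: SU _ _ qw (eqxx q) wX.
by apply: sub_count => -[//|src dst w] /= /andP[_ ->]; rewrite orbT.
Qed.

Lemma product_operand_final q c u :
  c \in computed_products q -> edge u (product G c) -> (q, u) \in final.
Proof.
rewrite inE => hc uc; exact: operands_in_memory (trace_valid sch) hc uc.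
Qed.

Lemma A_operands_bound q (K : {set 'I_dA}) :
  (forall g, g \in K ->
     exists2 c, c \in computed_products q & col c (FA alg) = delta_mx g 0) ->
  (#|K| <= #|[set g | homeA sch g == q]| + count (involves q) (trace sch))%N.
Proof.
move=> KP; apply: (@operands_bound _ _ (VA G) (valA (e:=G))) => [w wX||u w|g /KP[c cq cg]].
- rewrite !inE => /orP[] /imsetP[g _ [-> Ew]]; first by exists g; rewrite // Ew valA_in.
  by have [/(_ wX)[]] := parts_exclusive w; rewrite Ew inB_VB.
- by move=> w wX /norP[wA _]; apply: valA_add.
- exact: edge_VA.
have [uA [uB [uAX _ pc vA _]]] := product_operands G c.
exists uA => //; split; last by rewrite vA.
apply: product_operand_final cq _.
by have := set21 uA uB; rewrite -pc inE.
Qed.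

Lemma B_operands_bound q (K : {set 'I_dB}) :
  (forall h, h \in K ->
     exists2 c, c \in computed_products q & col c (FB alg) = delta_mx h 0) ->
  (#|K| <= #|[set h | homeB sch h == q]| + count (involves q) (trace sch))%N.
Proof.
move=> KP; apply: (@operands_bound _ _ (VB G) (valB (e:=G))) => [w wX||u w|g /KP[c cq cg]].
- rewrite !inE => /orP[] /imsetP[g _ [-> Ew]]; last by exists g; rewrite // Ew valB_in.
  by have [/(_ _ wX)[]] := parts_exclusive w; rewrite Ew inA_VA.
- by move=> w wX /norP[_ wB]; apply: valB_add.
- exact: edge_VB.
have [uA [uB [_ uBX pc _ vB]]] := product_operands G c.
exists uB => //; split; last by rewrite vB.
apply: product_operand_final cq _.
by have := set22 uA uB; rewrite -pc inE.
Qed.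

Lemma product_not_input c : ~~ is_input (product G c).
Proof.
have [_ nAC nBC] := parts_exclusive (product G c).
apply/norP; split; apply/negP => /codomP[g Eg].
  by apply: nAC (product_VC G c); rewrite Eg inA_VA.
by apply: nBC (product_VC G c); rewrite Eg inB_VB.
Qed.

Lemma product_computed_once c :
  count (computes (product G c)) (trace sch) = 1%N.
Proof.
have := trace_computes sch (product G c).
by rewrite -/(is_input _) (negPf (product_not_input c)).
Qed.

Lemma computed_products_cover c : exists q, c \in computed_products q.
Proof.
have : has (computes (product G c)) (trace sch) by rewrite has_count product_computed_once.
suff H es : has (computes (product G c)) es -> exists q, has (computes_on q (product G c)) es.
  by move=> /H[q qc]; exists q; rewrite inE.
elim: es => //= e es IH /orP[|/IH[q qc]]; last by exists q; rewrite qc orbT.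
by case: e => //= q w cw; exists q; rewrite eqxx cw.
Qed.

Lemma computed_products_sum : (r <= \sum_q #|computed_products q|)%N.
Proof.
apply: (@leq_trans (\sum_(c : 'I_r) 1)); first by rewrite sum1_card card_ord.
under eq_bigr => q _ do rewrite -sum1_card big_mkcond.
rewrite exchange_big; apply: leq_sum => c _.
by have [q qc] := computed_products_cover c; rewrite (bigD1 q) //= qc.
Qed.

(** Recomputation is excluded: two processors would give two events where one is allowed. Hence the
    other processors learn about the products of [q] only through what [q] sends. *)
Lemma computed_products_disjoint q q' c :
  c \in computed_products q -> c \in computed_products q' -> q = q'.
Proof.
rewrite !inE => hq hq'; apply/eqP/negPn/negP => qq'.
have := product_computed_once c.
suff : (1 < count (computes (product G c)) (trace sch))%N by lia.
have no_both e : computes_on q (product G c) e && computes_on q' (product G c) e = false.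
  case: e => //= q0 w; apply/negbTE/negP => /andP[/andP[/eqP E _] /andP[/eqP E' _]].
  by rewrite -E -E' eqxx in qq'.
have := count_predUI (computes_on q (product G c)) (computes_on q' (product G c)) (trace sch).
rewrite [X in (_ + X)%N](eq_count (a2 := pred0)) ?count_pred0; last exact: no_both.
have : (count (predU (computes_on q (product G c)) (computes_on q' (product G c)))
          (trace sch) <= count (computes (product G c)) (trace sch))%N.
  by apply: sub_count => -[q0 w /orP[]/andP[]|].
move: hq hq'; rewrite !has_count; lia.
Qed.

(** Project all values of the other processors onto the products of [q]. Their span starts at zero
    and grows by at most one dimension per element sent by [q]. The outputs stored elsewhere that
    use a product of [q] have independent projections, because a column of [FC] has at most one
    nonzero entry. *)
Lemma C_outputs_bound q :
  (forall i i' c, FC alg i c != 0 -> FC alg i' c != 0 -> i = i') ->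
  (#|[set i | [exists c in computed_products q, FC alg i c != 0%R]]| <=
    #|[set i | homeC sch i == q]| + count (involves q) (trace sch))%N.
Proof.
move=> FC1; set L := [set i | _]; set H := [set i | _].
pose P := computed_products q.
pose D : 'M[R]_r := diag_mx (\row_c (c \in P)%:R).
have mulD (m : 'rV[R]_r) c : (m *m D) 0 c = if c \in P then m 0 c else 0.
  by rewrite mul_mx_diag !mxE; case: ifP; rewrite ?mulr1 ?mulr0.
suff : (#|L :\: H| <= count (involves q) (trace sch))%N.
  move=> le; rewrite -(cardsID H L) leq_add //.
  exact/subset_leq_card/subsetIr.
(* Events of the other processors never compute a product in [P], so the products they do compute
   vanish under [D]. *)
pose ok e := if e is Compute q' w then
  (q' != q) ==> [forall c in P, w != product G c] else true.
have all_ok : all ok (trace sch).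
  rewrite -[all _ _]negbK -has_predC; apply/negP => has_bad.
  have [c [q' [q'q cP cq']]] : exists c q',
      [/\ q' != q, c \in P & has (computes_on q' (product G c)) (trace sch)].
    elim: (trace sch) has_bad => //= e es IH /orP[|/IH[c [q' [? ? h]]]]; last first.
      by exists c, q'; split=> //; rewrite h orbT.
    case: e => //= q' w; rewrite negb_imply => /andP[q'q /forall_inPn[c cP]].
    by rewrite negbK => /eqP->; exists c, q'; rewrite !eqxx.
  move: q'q; rewrite (@computed_products_disjoint q' q c) ?eqxx //.
  by rewrite inE.
have [||U [rU SU]] := @memory_span r 0 (predC1 q) (VC G) (fun w => valC w *m D)
    ok initial (trace sch) 0 (trace_valid sch) all_ok.
- move=> q' w U /= + q'q wC opU; rewrite /= in q'q; rewrite q'q /= => /forall_inP wP.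
  have [/codomP[c Ew]|wN] := boolP (w \in codom (product G)).
    rewrite Ew valC_product (_ : _ *m D = 0) ?sub0mx //.
    apply/rowP => c'; rewrite mulD !mxE; case: ifP => // c'P.
    have [Ec|//] := eqVneq c' c.
    by move: (wP _ c'P); rewrite Ew Ec eqxx.
  rewrite valC_add // mulmx_suml summx_sub // => u; rewrite inE => uw.
  rewrite -scalemxAl; apply: scalemx_sub; apply: opU => //.
  exact: edge_VC wN.
- move=> q' w + _ wC; have [_ nAC nBC] := parts_exclusive w.
  rewrite !inE => /orP[] /imsetP[g _ [_ Ew]].
    by case: nAC => //; rewrite Ew inA_VA.
  by case: nBC => //; rewrite Ew inB_VB.
apply: (@leq_trans (count (enters (predC1 q)) (trace sch))); last first.
  by apply: sub_count => -[//|src dst w] /=; rewrite negbK => /andP[-> _].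
apply: leq_trans (leq_trans rU _); last by rewrite mxrank0.
(* The empty case is split off to obtain a default column for [odflt]; [pivP] shows that the default
   is never taken on [L :\: H]. *)
have [->|/set0Pn[i0 i0L]] := eqVneq (L :\: H) set0; first by rewrite cards0.
have [c0 _] : exists c, c \in P.
  by move: i0L; rewrite !inE => /andP[_ /exists_inP[c cP _]]; exists c.
pose piv i := odflt c0 [pick c in P | FC alg i c != 0].
have pivP i : i \in L :\: H -> piv i \in P /\ FC alg i (piv i) != 0.
  move=> /setDP[+ _]; rewrite in_set => /exists_inP[c cP ic].
  rewrite /piv; case: pickP => [c' /andP[? ?]|/(_ c)] /=; first by [].
  by rewrite /= cP ic.
apply: (@rank_pivot_family _ _ _ _ _ (fun i => row i (FC alg) *m D) piv).
  move=> i j iL jL; have [jP jc] := pivP _ jL.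
  rewrite mulD jP mxE; apply/idP/eqP => [ic|->//]; exact: FC1 ic jc.
move=> i iL; rewrite -(out_val G); apply: SU (out_VC G i); first exact: trace_outputs.
by move: iL; rewrite !inE => /andP[].
Qed.

End Traces.

(** * The discrete Loomis-Whitney inequality *)

Lemma sum_sqr_le (I : finType) (A : {set I}) (f : I -> nat) :
  ((\sum_(i in A) f i) ^ 2 <= #|A| * \sum_(i in A) f i ^ 2)%N.
Proof.
have E1 : (#|A| * \sum_(i in A) f i ^ 2 = \sum_(i in A) \sum_(j in A) f j ^ 2)%N.
  by rewrite sum_nat_const.
have E2 : (#|A| * \sum_(i in A) f i ^ 2 = \sum_(i in A) \sum_(j in A) f i ^ 2)%N.
  by rewrite E1 exchange_big.
(* Doubling symmetrises the right side, which reduces the claim termwise to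
   [2 * (f i * f j) <= f i ^ 2 + f j ^ 2]. *)
rewrite -(leq_pmul2l (isT : 0 < 2)%N) [X in (_ <= X)%N]mul2n -addnn {1}E1 E2.
rewrite -big_split -mulnn big_distrlr big_distrr /=.
apply: leq_sum => i _; rewrite big_distrr -big_split /=.
apply: leq_sum => j _; rewrite [X in (_ <= X)%N]addnC; exact: nat_Cauchy.
Qed.

(* Cauchy-Schwarz over the fibres of the first projection; the pairs of points
   in a common fibre are then determined by the two other projections. *)
Lemma loomis_whitney (J L K : finType) (P : {set J * L * K}) :
  (#|P| ^ 2 <= #|[set (c.1.1, c.2) | c in P]| * #|[set (c.2, c.1.2) | c in P]| *
    #|[set c.1 | c in P]|)%N.
Proof.
set X := [set (c.1.1, c.2) | c in P]; set Y := [set (c.2, c.1.2) | c in P].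
set Z := [set c.1 | c in P].
pose fib z := [set c in P | c.1 == z].
have -> : #|P| = (\sum_(z in Z) #|fib z|)%N.
  rewrite -sum1_card (partition_big fst (mem Z)) => [|c cP]; last exact: imset_f.
  by apply: eq_bigr => z _; rewrite -sum1_card; apply: eq_bigl => c; rewrite inE.
apply: leq_trans (sum_sqr_le _ _) _; rewrite mulnC leq_mul2r; apply/orP; right.
(* Ordered pairs of points in a common fibre: their number is the sum of the squared fibre sizes. *)
pose W := [set d : (J * L * K) * (J * L * K) | [&& d.1 \in P, d.2 \in P & d.1.1 == d.2.1]].
have <- : #|W| = (\sum_(z in Z) #|fib z| ^ 2)%N.
  rewrite -sum1_card (partition_big (fun d => d.1.1) (mem Z)) => [|d].
    apply: eq_bigr => z _; rewrite -mulnn -cardsX -sum1_card; apply: eq_bigl => d.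
    rewrite !inE; case: (eqVneq d.1.1 z) => [<-|_]; last by rewrite !andbF.
    by rewrite !andbT eq_sym.
  by rewrite inE => /and3P[dP _ _]; apply: imset_f.
rewrite -cardsX.
rewrite -(@card_in_imset _ _ (fun d : (J * L * K) * (J * L * K) =>
  ((d.1.1.1, d.1.2), (d.2.2, d.2.1.2))) W).
  apply/subset_leq_card/subsetP => _ /imsetP[d + ->]; rewrite !inE => /and3P[d1 d2 _] /=.
  by apply/andP; split; apply/imsetP; [exists d.1 | exists d.2].
move=> [[[j l] k] [[j2 l2] k2]] [[[j' l'] k'] [[j2' l2'] k2']]; rewrite !inE /=.
by move=> /and3P[_ _ /eqP[-> ->]] /and3P[_ _ /eqP[-> ->]] [-> -> -> ->].
Qed.

(** * Splitting, merging and counting nondecreasing tuples *)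

Lemma perm_mask_negb (T : eqType) (m : bitseq) (s : seq T) :
  size m = size s -> perm_eq (mask m s ++ mask (map negb m) s) s.
Proof.
elim: s m => [|x s IH] [|b m] //= [/IH ms].
case: b => /=; first by rewrite perm_cons.
by rewrite -cat1s perm_catCA /= perm_cons.
Qed.

(** The mask records from which of the two sequences each entry of the merge is taken. *)
Lemma merge_mask (T : Type) (leT : rel T) (a b : seq T) :
  exists2 m, size m = (size a + size b)%N &
    mask m (merge leT a b) = a /\ mask (map negb m) (merge leT a b) = b.
Proof.
elim: a b => [|x a IHa] b.
  exists (nseq (size b) false); first by rewrite size_nseq.
  by rewrite map_nseq mask_true // mask_false.
elim: b => [|y b [m ms [ma mb]]] /=.
  exists (true :: nseq (size a) true); first by rewrite /= size_nseq addn0.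
  by rewrite /= map_nseq mask_true // mask_false.
case: ifP => _.
  have [m' m's [m'a m'b]] := IHa (y :: b); exists (true :: m') => /=; first by rewrite m's.
  by rewrite m'a m'b.
exists (false :: m) => /=; first by rewrite ms /= addnS.
by split; [rewrite -[in RHS]ma | rewrite -[in RHS]mb].
Qed.

Section Chi.
Variables n q r : nat.

Lemma chi_exists (j : inc_tuple n q) (k : inc_tuple n r) :
  exists g : inc_tuple n (q + r), (val j, val k) \in chi (val g).
Proof.
pose leI := relpre (val : 'I_n -> nat) leq.
have [m ms [mj mk]] := merge_mask leI (val (val j)) (val (val k)).
have gs : size (merge leI (val (val j)) (val (val k))) == (q + r)%N.
  by rewrite size_merge size_cat !size_tuple.
have gsort : sorted leq (map val (Tuple gs)).
  rewrite sorted_map; apply: merge_sorted => [x y||]; first exact: leq_total.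
    by have := valP j; rewrite /= sorted_map.
  by have := valP k; rewrite /= sorted_map.
exists (Sub (Tuple gs) gsort); rewrite SubK inE /=.
have ms' : size m == (q + r)%N by rewrite ms !size_tuple.
by apply/existsP; exists (Tuple ms'); rewrite /= mj mk !eqxx.
Qed.

(** Both tuples are sorted rearrangements of the concatenated pair. Each column of the three
    matrices therefore has a single nonzero entry. *)
Lemma chi_unique (g g' : inc_tuple n (q + r)) jk :
  jk \in chi (val g) -> jk \in chi (val g') -> g = g'.
Proof.
have chi_perm (h : inc_tuple n (q + r)) :
    jk \in chi (val h) -> perm_eq (val jk.1 ++ val jk.2) (val (val h)).
  rewrite inE => /existsP[m /andP[/eqP-> /eqP->]].
  by apply: perm_mask_negb; rewrite !size_tuple.
move=> /chi_perm; rewrite perm_sym => gp /chi_perm g'p.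
apply/val_inj/val_inj/(inj_map val_inj).
apply: (sorted_eq leq_trans anti_leq (valP g) (valP g')).
exact/perm_map/(perm_trans gp).
Qed.

(** A pair in [chi k] is determined by a mask that selects it. *)
Lemma card_chi (k : (q + r).-tuple 'I_n) : (#|chi k| <= 2 ^ (q + r))%N.
Proof.
pose sel (jl : q.-tuple 'I_n * r.-tuple 'I_n) (m : (q + r).-tuple bool) :=
  (val jl.1 == mask m k) && (val jl.2 == mask (map negb m) k).
pose f jl := odflt [tuple of nseq (q + r) true] [pick m | sel jl m].
have fP jl : jl \in chi k -> sel jl (f jl).
  rewrite inE => /existsP[m jlm]; rewrite /f; case: pickP => //= /(_ m).
  by rewrite /sel jlm.
rewrite -card_bool -card_tuple -(@card_in_imset _ _ f (mem (chi k))) ?max_card //.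
move=> [j l] [j' l'] /fP/andP[/eqP/= Ej /eqP/= El] /fP/andP[/eqP/= Ej' /eqP/= El'] ff.
by congr pair; apply: val_inj; rewrite /= ?Ej ?El ff -?Ej' -?El'.
Qed.

End Chi.

Lemma card_inc_tuple n d :
  #|{: inc_tuple n d}| = #|[set t : d.-tuple 'I_n | sorted leq (map val t)]|.
Proof. by rewrite card_sig cardsE. Qed.

Lemma card_inc_tuple_le n d : (#|{: inc_tuple n d}| <= n ^ d)%N.
Proof.
by rewrite card_inc_tuple (leq_trans (max_card _)) // card_tuple card_ord.
Qed.

Lemma card_inc_tuple_ge n d : (0 < n)%N -> (n ^ d <= d`! * #|{: inc_tuple n d}|)%N.
Proof.
case: n => // n _; rewrite card_inc_tuple card_sorted_tuples mulnC bin_ffact.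
(* The right side has become a falling factorial with [d] factors, each at least the dimension. *)
elim: d => // d IH; rewrite addSn ffactSS expnS leq_mul //.
by rewrite ltnS leq_addl.
Qed.

(** Passes from the pairs counted by Loomis-Whitney to the stored entries of a tensor: one entry
    accounts for at most [2 ^ (q + r)] pairs. *)
Lemma card_chi_pairs_le n q r (X : {set inc_tuple n q * inc_tuple n r})
    (K : {set 'I_#|{: inc_tuple n (q + r)}|}) :
  (forall jk, jk \in X -> exists2 g, g \in K &
     (val jk.1, val jk.2) \in chi (val (enum_val g : inc_tuple n (q + r)))) ->
  (#|X| <= #|K| * 2 ^ (q + r))%N.
Proof.
move=> XK.
have inj_vals : injective (fun jk : inc_tuple n q * inc_tuple n r => (val jk.1, val jk.2)).
  by move=> [j k] [j' k'] /= [/val_inj-> /val_inj->].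
rewrite -(card_imset _ inj_vals) -sum_nat_const.
apply: (@leq_trans #|\bigcup_(g in K) chi (val (enum_val g : inc_tuple n (q + r)))|).
  apply/subset_leq_card/subsetP => _ /imsetP[jk /XK[g gK jkg] ->].
  by apply/bigcupP; exists g.
apply: (big_ind2 (fun (A : {set _}) m => (#|A| <= m)%N)) => [|A a B b Aa Bb|g _].
- by rewrite cards0.
- by rewrite (leq_trans (leq_card_setU _ _).1) ?leq_add.
- exact: card_chi.
Qed.

(** * Operands and output coefficients of [Psi] *)

Section PsiOperands.
Variables (R : realType) (n s t v : nat).
Implicit Type c : 'I_#|{: psi_column n s t v}|.

Lemma Psi_FA_col c (g : 'I_#|{: inc_tuple n (s + v)}|) :
  let: (j, l, k) := (enum_val c : psi_column n s t v) in
  (val j, val k) \in chi (val (enum_val g : inc_tuple n (s + v))) ->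
  col c (FA (Psi R n s t v)) = delta_mx g 0.
Proof.
case Ec : (enum_val c : psi_column n s t v) => [[j l] k] jkg.
apply/colP => g'; rewrite !mxE Ec andbT.
cbv zeta; case: ifP => [jkg'|jkg'].
  by rewrite (enum_val_inj (chi_unique jkg' jkg)) eqxx.
by case: (eqVneq g' g) jkg' => // ->; rewrite jkg.
Qed.

Lemma Psi_FB_col c (h : 'I_#|{: inc_tuple n (v + t)}|) :
  let: (j, l, k) := (enum_val c : psi_column n s t v) in
  (val k, val l) \in chi (val (enum_val h : inc_tuple n (v + t))) ->
  col c (FB (Psi R n s t v)) = delta_mx h 0.
Proof.
case Ec : (enum_val c : psi_column n s t v) => [[j l] k] klh.
apply/colP => h'; rewrite !mxE Ec andbT.
cbv zeta; case: ifP => [klh'|klh'].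
  by rewrite (enum_val_inj (chi_unique klh' klh)) eqxx.
by case: (eqVneq h' h) klh' => // ->; rewrite klh.
Qed.

Lemma rho_neq0 (k : v.-tuple 'I_n) : rho R k != 0.
Proof.
rewrite /rho mulf_neq0 ?invr_eq0 ?pnatr_eq0 -?lt0n ?fact_gt0 //.
by apply: prodn_gt0 => i; apply: fact_gt0.
Qed.

Lemma Psi_FC_neq0 c (i : 'I_#|{: inc_tuple n (s + t)}|) :
  let: (j, l, k) := (enum_val c : psi_column n s t v) in
  (FC (Psi R n s t v) i c != 0) =
    ((val j, val l) \in chi (val (enum_val i : inc_tuple n (s + t)))).
Proof.
case Ec : (enum_val c : psi_column n s t v) => [[j l] k].
rewrite mxE Ec; cbv zeta; case: ifP => _; last by rewrite eqxx.
apply: mulf_neq0; last exact: rho_neq0.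
by rewrite mulf_neq0 // pnatr_eq0 -lt0n fact_gt0.
Qed.

Lemma Psi_FC_single c i i' :
  FC (Psi R n s t v) i c != 0 -> FC (Psi R n s t v) i' c != 0 -> i = i'.
Proof.
have := Psi_FC_neq0 c i; have := Psi_FC_neq0 c i'.
case: (enum_val c : psi_column n s t v) => [[j l] k] -> -> ji ji'.
exact/enum_val_inj/(chi_unique ji ji').
Qed.

End PsiOperands.

(** * Communication of a processor with at least an average load *)

(** Loomis-Whitney is applied to the products of one processor. The factorials come from replacing
    the number of columns by [n ^ (s + t + v)], the powers of two from the splittings of each entry;
    everything is scaled by [p] to stay in integers. *)
Lemma Psi_processor_bound (R : realType) (n s t v p : nat)
    (G : execution_dag (Psi R n s t v)) (sch : schedule G p) :
  (0 < n)%N -> (0 < p)%N -> storage_balanced sch ->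
  (p * (n ^ (s + t + v)) ^ 2 <=
    (s`! * t`! * v`!) ^ 2 * (2 ^ (s + v) * 2 ^ (v + t) * 2 ^ (s + t)) *
    ((n ^ (s + v) + p * horizontal_cost sch) *
     (n ^ (v + t) + p * horizontal_cost sch) *
     (n ^ (s + t) + p * horizontal_cost sch)))%N.
Proof.
move=> n0 p0 bal; set W := horizontal_cost sch.
set M := #|{: psi_column n s t v}|.
have [q Mq] : exists q, (M <= p * #|computed_products sch q|)%N.
  apply/existsP; apply: contraT; rewrite negb_exists => /forallP lt_M.
  have Msum := computed_products_sum sch.
  (* The [+ 1] encodes strictness: summed over the processors it leaves a surplus of [p > 0], a
     contradiction. *)
  have : (\sum_(q < p) (p * #|computed_products sch q| + 1) <= \sum_(q < p) M)%N.
    by apply: leq_sum => q _; rewrite addn1 ltnNge lt_M.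
  rewrite big_split /= -big_distrr sum1_card sum_nat_const card_ord => lt_sum.
  have := leq_trans lt_sum (leq_mul (leqnn p) Msum).
  by rewrite -[X in (_ <= X)%N]addn0 leq_add2l leqNgt p0.
set P := computed_products sch q in Mq.
have costW : (count (involves q) (trace sch) <= W)%N.
  exact: (@leq_bigmax _ (fun q : 'I_p => count (involves q) (trace sch)) q).
pose KA := [set g | [exists c in P, col c (FA (Psi R n s t v)) == delta_mx g 0]].
pose KB := [set h | [exists c in P, col c (FB (Psi R n s t v)) == delta_mx h 0]].
pose KC := [set i | [exists c in P, FC (Psi R n s t v) i c != 0]].
have [balA balB balC] := bal q.
have balance d h K : (p * h = #|{: inc_tuple n d}|)%N ->
    (K <= h + count (involves q) (trace sch))%N -> (p * K <= n ^ d + p * W)%N.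
  move=> ph Kh; apply: leq_trans (leq_mul (leqnn p) Kh) _.
  by rewrite mulnDr ph leq_add ?card_inc_tuple_le // leq_mul2l costW orbT.
have leKA : (p * #|KA| <= n ^ (s + v) + p * W)%N.
  apply: balance balA _; apply: A_operands_bound => g.
  by rewrite inE => /exists_inP[c cP /eqP]; exists c.
have leKB : (p * #|KB| <= n ^ (v + t) + p * W)%N.
  apply: balance balB _; apply: B_operands_bound => g.
  by rewrite inE => /exists_inP[c cP /eqP]; exists c.
have leKC : (p * #|KC| <= n ^ (s + t) + p * W)%N.
  by apply: balance balC _; apply: C_outputs_bound => i i' c; apply: Psi_FC_single.
pose Pc : {set inc_tuple n s * inc_tuple n t * inc_tuple n v} := [set enum_val c | c in P].
have cardPc : #|Pc| = #|P| by rewrite card_imset //; apply: enum_val_inj.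
have leA : (#|[set (c.1.1, c.2) | c in Pc]| <= #|KA| * 2 ^ (s + v))%N.
  apply: card_chi_pairs_le => _ /imsetP[_ /imsetP[c cP ->] ->].
  have [g jkg] := chi_exists (enum_val c).1.1 (enum_val c).2.
  exists (enum_rank g); last by rewrite enum_rankK.
  rewrite inE; apply/exists_inP; exists c => //; apply/eqP.
  have := @Psi_FA_col R n s t v c (enum_rank g); rewrite enum_rankK.
  by move: jkg; case: (enum_val c : psi_column n s t v) => [[j l] k] jkg; apply.
have leB : (#|[set (c.2, c.1.2) | c in Pc]| <= #|KB| * 2 ^ (v + t))%N.
  apply: card_chi_pairs_le => _ /imsetP[_ /imsetP[c cP ->] ->].
  have [h klh] := chi_exists (enum_val c).2 (enum_val c).1.2.
  exists (enum_rank h); last by rewrite enum_rankK.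
  rewrite inE; apply/exists_inP; exists c => //; apply/eqP.
  have := @Psi_FB_col R n s t v c (enum_rank h); rewrite enum_rankK.
  by move: klh; case: (enum_val c : psi_column n s t v) => [[j l] k] klh; apply.
have leC : (#|[set c.1 | c in Pc]| <= #|KC| * 2 ^ (s + t))%N.
  apply: card_chi_pairs_le => _ /imsetP[_ /imsetP[c cP ->] ->].
  have [i jli] := chi_exists (enum_val c).1.1 (enum_val c).1.2.
  exists (enum_rank i); last by rewrite enum_rankK.
  rewrite inE; apply/exists_inP; exists c => //.
  have := @Psi_FC_neq0 R n s t v c (enum_rank i); rewrite enum_rankK.
  by move: jli; case: (enum_val c : psi_column n s t v) => [[j l] k] jli ->.
have := loomis_whitney Pc; rewrite cardPc => LW.
have leN : (n ^ (s + t + v) <= s`! * t`! * v`! * (p * #|P|))%N.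
  apply: leq_trans (leq_mul (leqnn _) Mq).
  rewrite /M !card_prod !expnD.
  have leS := card_inc_tuple_ge s n0; have leT := card_inc_tuple_ge t n0.
  have := leq_mul (leq_mul leS leT) (card_inc_tuple_ge v n0).
  by congr (_ <= _)%N; ring.
apply: (@leq_trans (p * (s`! * t`! * v`! * (p * #|P|)) ^ 2)).
  by rewrite leq_mul2l leq_sqr leN orbT.
(* One factor [p] comes from the statement and two from the square; each of the three index sets
   then absorbs one. *)
apply: (@leq_trans (p ^ 3 * (s`! * t`! * v`!) ^ 2 *
    (#|KA| * 2 ^ (s + v) * (#|KB| * 2 ^ (v + t)) * (#|KC| * 2 ^ (s + t))))).
  apply: (@leq_trans (p ^ 3 * (s`! * t`! * v`!) ^ 2 * #|P| ^ 2)).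
    by apply: eq_leq; ring.
  by rewrite leq_mul //; apply: leq_trans LW _; rewrite !leq_mul.
apply: (@leq_trans ((s`! * t`! * v`!) ^ 2 * (2 ^ (s + v) * 2 ^ (v + t) * 2 ^ (s + t)) *
    ((p * #|KA|) * (p * #|KB|) * (p * #|KC|)))).
  by apply: eq_leq; ring.
by rewrite leq_mul // !leq_mul.
Qed.

(** * From the product inequality to [W_O] *)

Lemma W_O_ge0 (R : realType) n x y z p : 0 <= W_O R n x y z p.
Proof.
rewrite /W_O; case: ifP => _; first exact: powR_ge0.
by case: ifP => _; rewrite ?mulr_ge0 ?powR_ge0.
Qed.

(* The three branches of [W_O] are the three arguments of a minimum. *)
Lemma W_O_bounds (R : realType) (n x y z p : nat) :
  (0 < n)%N -> (0 < p)%N -> (x <= y <= z)%N ->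
  [/\ W_O R n x y z p <= (n ^ (x + y))%:R,
      W_O R n x y z p ^+ 2 * p%:R <= (n ^ (2 * x + y + z))%:R &
      W_O R n x y z p ^+ 3 * p%:R ^+ 2 <= (n ^ (x + y + z))%:R ^+ 2].
Proof.
move=> n0 p0 /andP[xy yz]; set T := W_O R n x y z p.
have T0 : 0 <= T := W_O_ge0 _ _ _ _ _ _.
have pR : (0 : R) < p%:R by rewrite ltr0n.
have expn_le a b : (a <= b)%N -> (n ^ a <= n ^ b)%N by apply: leq_pexp2l.
have sqr_bound (a b : R) k : (0 < k)%N -> 0 <= a -> 0 <= b -> a ^+ k <= b ^+ k -> a <= b.
  by move=> k0 a0 b0; rewrite ler_pXn2r.
(* Since [2 * x + y + z = 2 * (x + y) + (z - y)], the second bound implies the first in this range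
   of [p]. *)
have small : (n ^ (z - y) <= p)%N -> T ^+ 2 * p%:R <= (n ^ (2 * x + y + z))%:R ->
    T <= (n ^ (x + y))%:R.
  move=> zyp T2; apply: (@sqr_bound _ _ 2%N) => //.
  rewrite -(ler_pM2r pR) (le_trans T2) // -natrX -natrM ler_nat.
  apply: leq_trans (leq_mul (leqnn _) zyp); rewrite -expnM -expnD expn_le //; lia.
rewrite {}/T /W_O in T0 small *; case: ifP T0 small => [yzp|yzp].
  set T := _ `^ _ => T0 small.
  have T3 : T ^+ 3 * p%:R ^+ 2 = (n ^ (x + y + z))%:R ^+ 2.
    rewrite -powR_mulrn ?powR_ge0 // -powRrM (_ : 2 / 3 * 3 = 2%:R); last by field.
    by rewrite powR_mulrn ?divr_ge0 // expr_div_n divfK // expf_neq0 // gt_eqF.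
  have T2 : T ^+ 2 * p%:R <= (n ^ (2 * x + y + z))%:R.
    (* Cubing and multiplying by [p] produces the square of [T3]; the lower bound on [p] supplies
       the missing power of [n]. *)
    apply: (@sqr_bound _ _ 3%N) => //; first by rewrite mulr_ge0 ?exprn_ge0 // ltW.
    rewrite -(ler_pM2r pR).
    have -> : (T ^+ 2 * p%:R) ^+ 3 * p%:R = (T ^+ 3 * p%:R ^+ 2) ^+ 2 by ring.
    rewrite T3 -!natrX -natrM ler_nat.
    apply: leq_trans (leq_mul (leqnn _) (ltnW yzp)).
    by rewrite -!expnM -expnD expn_le //; lia.
  split=> //; last by rewrite T3.
  by apply: small => //; apply: leq_trans (ltnW yzp); apply: expn_le; lia.
case: ifP => [zyp|zyp].
  set T := _ * _ => T0 small.
  have T2 : T ^+ 2 * p%:R = (n ^ (2 * x + y + z))%:R.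
    rewrite exprMn -[(_ `^ _) ^+ 2]powR_mulrn ?powR_ge0 // -powRrM.
    rewrite (_ : 1 / 2 * 2 = 1); last by field.
    rewrite powRr1 ?divr_ge0 // -mulrA divfK ?gt_eqF // -natrX -natrM.
    by rewrite -expnM -expnD; congr (n ^ _)%:R; lia.
  split; [|by rewrite T2|].
    by apply: small; rewrite ?T2 // ltnW.
  apply: (@sqr_bound _ _ 2%N); rewrite ?exprn_ge0 //.
    by rewrite mulr_ge0 // exprn_ge0.
  have -> : (T ^+ 3 * p%:R ^+ 2) ^+ 2 = (T ^+ 2 * p%:R) ^+ 3 * p%:R by ring.
    rewrite T2 -!natrX -natrM ler_nat.
    apply: (@leq_trans ((n ^ (2 * x + y + z)) ^ 3 * n ^ (y + z - 2 * x))).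
      by rewrite leq_mul2l leqNgt yzp orbT.
    by rewrite -!expnM -expnD expn_le //; lia.
move=> _ _; move/negbT: zyp; rewrite -leqNgt => zyp.
split=> //; rewrite -?natrX -natrM ler_nat.
  apply: leq_trans (leq_mul (leqnn _) zyp) _; rewrite -expnM -expnD expn_le //; lia.
(* The exponents compare as [3 * x + y + 2 * z <= 2 * (x + y + z)], which is [x <= y]. *)
apply: (@leq_trans ((n ^ (x + y)) ^ 3 * (n ^ (z - y)) ^ 2)).
  by rewrite leq_mul2l leq_sqr zyp orbT.
by rewrite -!expnM -expnD expn_le //; lia.
Qed.

(** Minimum and median are the two smallest of the three numbers, so their sum is below every
    pairwise sum, that is, below every tensor order. *)
Lemma median3E s t v (x := minn s (minn t v)) (y := median3 s t v) (z := maxn s (maxn t v)) :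
  [/\ (x <= y <= z)%N, (x + y + z = s + t + v)%N,
      [/\ x + y <= s + v, x + y <= v + t & x + y <= s + t]%N &
      [/\ x <= s, x <= t & x <= v]%N].
Proof.
suff yE : y = (s + t + v - x - z)%N by split; try split; rewrite /x /z ?yE /x /z; lia.
rewrite /y /x /z /median3 /sort /=.
by rewrite /merge; repeat case: ifP => ?; rewrite /=; lia.
Qed.

(* Expanding the product, every term but the first contains a power of [W],
   which the bounds on [T] make negligible; the first is negligible because
   [p] is large. *)
Lemma cost_lower_bound (R : realFieldType) (D p a b c N W T : R) :
  1 <= D -> 2 * D <= p -> 0 < N -> 0 <= a -> 0 <= b -> 0 <= c -> 0 <= W -> 0 <= T ->
  a * b * c = N ^+ 2 ->
  T <= a -> T <= b -> T <= c ->
  T ^+ 2 * p <= a * b -> T ^+ 2 * p <= b * c -> T ^+ 2 * p <= a * c ->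
  T ^+ 3 * p ^+ 2 <= N ^+ 2 ->
  p * N ^+ 2 <= D * ((a + p * W) * (b + p * W) * (c + p * W)) ->
  (15 * D)^-1 * T <= W.
Proof.
move=> D1 Dp N0 a0 b0 c0 W0 T0 abc Ta Tb Tc Tab Tbc Tac TN main.
have D0 : 0 < D by lra.
have p0 : 0 < p by lra.
rewrite leNgt; apply/negP => WT.
(* The expansion has 3 + 3 + 1 = 7 terms containing [W], each at most [e * N ^+ 2] after removing
   the factor [D * p]. Together they give 7/15 of [p * N ^+ 2], and the leading term at most 1/2 of
   it since [2 * D <= p]; the total stays below 1. *)
set e := (15 * D)^-1 in WT *.
have eD : e * D = 15^-1 by rewrite /e; field; rewrite gt_eqF.
have e0 : 0 < e by rewrite invr_gt0; lra.
have e1 : e <= 1 by rewrite invf_le1; lra.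
have NN : 0 < N ^+ 2 by rewrite exprn_gt0.
have {}WT : W <= e * T := ltW WT.
have eT0 : 0 <= e * T by rewrite mulr_ge0 // ltW.
have W1 : W * (a * b + b * c + a * c) <= 3 * (e * N ^+ 2).
  apply: (@le_trans _ _ (e * T * (a * b + b * c + a * c))).
    by apply: ler_wpM2r => //; rewrite !addr_ge0 // mulr_ge0.
  rewrite -mulrA (mulrCA 3) ler_pM2l //.
  have : T * (a * b) <= N ^+ 2 by rewrite -abc mulrC ler_wpM2l // mulr_ge0.
  have : T * (b * c) <= N ^+ 2 by rewrite -abc -mulrA ler_wpM2r // mulr_ge0.
  have : T * (a * c) <= N ^+ 2 by rewrite -abc mulrAC mulrC ler_wpM2l // mulr_ge0.
  lra.
have W2 : W ^+ 2 * p * (a + b + c) <= 3 * (e * N ^+ 2).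
  apply: (@le_trans _ _ ((e * T) ^+ 2 * p * (a + b + c))).
    by rewrite !ler_wpM2r // ?ler_sqr ?nnegrE // ?(ltW p0) // !addr_ge0.
  apply: (@le_trans _ _ (e * (T ^+ 2 * p * (a + b + c)))).
    have -> : (e * T) ^+ 2 * p * (a + b + c) = e * (e * (T ^+ 2 * p * (a + b + c))) by ring.
    rewrite ler_pM2l //; apply: ler_piMl => //.
    by rewrite !mulr_ge0 ?sqr_ge0 ?(ltW p0) ?addr_ge0.
  rewrite (mulrCA 3) ler_pM2l //.
  have : T ^+ 2 * p * c <= N ^+ 2 by rewrite -abc ler_wpM2r.
  have : T ^+ 2 * p * a <= N ^+ 2.
    by rewrite -abc (_ : a * b * c = b * c * a) ?ler_wpM2r //; ring.
  have : T ^+ 2 * p * b <= N ^+ 2.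
    by rewrite -abc (_ : a * b * c = a * c * b) ?ler_wpM2r //; ring.
  lra.
have W3 : W ^+ 3 * p ^+ 2 <= e * N ^+ 2.
  apply: (@le_trans _ _ ((e * T) ^+ 3 * p ^+ 2)).
    by rewrite ler_wpM2r ?sqr_ge0 // lerXn2r ?nnegrE.
  have -> : (e * T) ^+ 3 * p ^+ 2 = e * (e ^+ 2 * (T ^+ 3 * p ^+ 2)) by ring.
  rewrite ler_pM2l // (le_trans _ TN) //; apply: ler_piMl.
    by rewrite mulr_ge0 ?exprn_ge0 ?(ltW p0).
  by rewrite exprn_ile1 // ltW.
have E : D * ((a + p * W) * (b + p * W) * (c + p * W)) =
    D * N ^+ 2 + D * p * (W * (a * b + b * c + a * c) + W ^+ 2 * p * (a + b + c) + W ^+ 3 * p ^+ 2).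
  by rewrite -abc; ring.
rewrite {}E in main.
have rest : D * p * (W * (a * b + b * c + a * c) + W ^+ 2 * p * (a + b + c) + W ^+ 3 * p ^+ 2)
    <= D * p * (7 * (e * N ^+ 2)).
  by rewrite ler_pM2l ?mulr_gt0 //; lra.
have E : D * p * (7 * (e * N ^+ 2)) = 7 / 15 * (p * N ^+ 2).
  by transitivity (e * D * 7 * (p * N ^+ 2)); [ring|rewrite eD; field].
rewrite {}E in rest.
have : 2 * D * N ^+ 2 <= p * N ^+ 2 by rewrite ler_pM2r.
have : 0 < p * N ^+ 2 by rewrite mulr_gt0.
lra.
Qed.

Theorem theorem10p3 (R : realType) (s t v : nat) :
  exists (gamma : R) (n0 p0 : nat), 0 < gamma /\
  forall n p : nat, (n0 <= n)%N -> (p0 <= p)%N ->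
    (p %| #|{: inc_tuple n (s + v)}|)%N ->
    (p %| #|{: inc_tuple n (v + t)}|)%N ->
    (p %| #|{: inc_tuple n (s + t)}|)%N ->
    (p %| #|{: psi_column n s t v}|)%N ->
    forall (G : execution_dag (Psi R n s t v)) (sch : schedule G p),
      storage_balanced sch ->
      gamma * W_O R n (minn s (minn t v)) (median3 s t v) (maxn s (maxn t v)) p
        <= (horizontal_cost sch)%:R.
Proof.
pose D := ((s`! * t`! * v`!) ^ 2 * (2 ^ (s + v) * 2 ^ (v + t) * 2 ^ (s + t)))%N.
have D0 : (0 < D)%N by rewrite /D !(muln_gt0, expn_gt0, fact_gt0).
(* The constant and the threshold on [p] are those of [cost_lower_bound], with [D] taken from
   [Psi_processor_bound]. *)
exists (15 * D%:R)^-1, 1%N, (2 * D)%N.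
split; first by rewrite invr_gt0 mulr_gt0 ?ltr0n.
move=> n p n0 Dp _ _ _ _ G sch bal.
have p0 : (0 < p)%N by apply: leq_trans Dp; rewrite muln_gt0.
have [xyz sum_xyz [xy_sv xy_vt xy_st] [xs xt xv]] := median3E s t v.
have [] := @W_O_bounds R n _ _ _ p n0 p0 xyz.
have T0 := W_O_ge0 R n (minn s (minn t v)) (median3 s t v) (maxn s (maxn t v)) p.
move: (W_O _ _ _ _ _ _) T0 => T T0 T1 T2; rewrite sum_xyz => T3.
have expn_le a b : (a <= b)%N -> (n ^ a)%:R <= (n ^ b)%:R :> R.
  by move=> ab; rewrite ler_nat leq_pexp2l.
apply: (@cost_lower_bound R D%:R p%:R (n ^ (s + v))%:R (n ^ (v + t))%:R
  (n ^ (s + t))%:R (n ^ (s + t + v))%:R) => //.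
- by rewrite ler1n.
- by rewrite -natrM ler_nat.
- by rewrite ltr0n expn_gt0 n0.
- by rewrite -!natrM -natrX -!expnD -expnM; congr (n ^ _)%:R; lia.
- exact: le_trans T1 (expn_le _ _ xy_sv).
- exact: le_trans T1 (expn_le _ _ xy_vt).
- exact: le_trans T1 (expn_le _ _ xy_st).
(* The exponent [2 * x + y + z] equals [x + (s + t + v)], and two tensor orders add up to
   [s + t + v] plus the parameter they share, which is at least [x]. *)
- by apply: le_trans T2 _; rewrite -natrM -expnD; apply: expn_le; lia.
- by apply: le_trans T2 _; rewrite -natrM -expnD; apply: expn_le; lia.
- by apply: le_trans T2 _; rewrite -natrM -expnD; apply: expn_le; lia.
have := Psi_processor_bound n0 p0 bal.
by rewrite -/D -(ler_nat R) !(natrM, natrD, natrX).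
Qed.
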